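(* Let $f:\mathbb{R}^n\to\mathbb{R}\cup\{+\infty\}$ be a polyhedral M-convex function with bounded $\operatorname{dom}_{\mathbb{R}} f$ and $x_0\in\operatorname{dom}_{\mathbb{R}} f$. Consider algorithm PM-LSD2: set $x:=x_0$; while $\phi_{\mathbb{R}}(x)<0$, replace $x$ by the output of PM-IncSlope$(x)$; when $\phi_{\mathbb{R}}(x)=0$ output $x$. Then PM-LSD2 terminates after finitely many calls of PM-IncSlope, and its output is a minimizer of $f$.
   Context: $N=\{1,\dots,n\}$; $\chi_i$ is the $i$-th unit vector. $\operatorname{dom}_{\mathbb{R}} f=\{x\in\mathbb{R}^n:f(x)<+\infty\}$. A polyhedral convex function $f:\mathbb{R}^n\to\mathbb{R}\cup\{+\infty\}$ (epigraph a polyhedron, $\operatorname{dom}_{\mathbb{R}} f\neq\emptyset$) is M-convex if for all $x,y\in\operatorname{dom}_{\mathbb{R}} f$ and every $i$ with $x(i)>y(i)$ there exist $j$ with $x(j)<y(j)$ and $\epsilon_0>0$ such that $f(x)+f(y)\ge f(x-\epsilon(\chi_i-\chi_j))+f(y+\epsilon(\chi_i-\chi_j))$ for all $\epsilon\in[0,\epsilon_0]$. For $x\in\operatorname{dom}_{\mathbb{R}} f$, $f'_{\mathbb{R}}(x;i,j)=\lim_{\alpha\downarrow0}(f(x+\alpha(\chi_i-\chi_j))-f(x))/\alpha$ (possibly $+\infty$), $\phi_{\mathbb{R}}(x)=\min_{i,j\in N}f'_{\mathbb{R}}(x;i,j)$, and $\bar c_{\mathbb{R}}(x;i,j)=\max\{\lambda\ge0: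 f(x+\lambda(\chi_i-\chi_j))-f(x)=\lambda f'_{\mathbb{R}}(x;i,j)\}$. Procedure PM-IncSlope$(x)$ (for $\phi_{\mathbb{R}}(x)<0$): set $y:=x$; for each $i\in N$ (each once, arbitrary order) and each $j\in N\setminus\{i\}$ (each once, arbitrary order), if $f'_{\mathbb{R}}(y;i,j)=\phi_{\mathbb{R}}(x)$ replace $y$ by $y+\bar c_{\mathbb{R}}(y;i,j)(\chi_i-\chi_j)$; output $y$. *)

(* Defs.v *)
From HB Require Import structures.
From mathcomp Require Import all_boot all_order all_algebra.
From mathcomp Require Import all_classical all_reals all_analysis.
Set Implicit Arguments. Unset Strict Implicit. Unset Printing Implicit Defensive.
Import Order.TTheory GRing.Theory Num.Theory.
Import numFieldNormedType.Exports.
Local Open Scope classical_set_scope.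
Local Open Scope ring_scope.

Section Defs.
Variables (R : realType) (n : nat).
Notation vec := 'rV[R]_n.

Definition chi (i : 'I_n) : vec := delta_mx 0 i.
Definition dirv (i j : 'I_n) : vec := chi i - chi j.

Definition dotv (u v : vec) : R := \sum_(k < n) u 0 k * v 0 k.

Definition domR (f : vec -> \bar R) : set vec := [set x | (f x < +oo)%E].

(* polyhedral convex function R^n -> R ∪ {+oo}: never -oo, nonempty
   effective domain, and epigraph {(x,t) | f x <= t} is a polyhedron, i.e.
   a finite intersection of closed half-spaces of R^n x R. *)
Definition polyhedral_convex (f : vec -> \bar R) : Prop :=
  [/\ forall x, f x <> -oo%E,
      exists x, domR f x &
      exists (m : nat) (a : 'I_m -> vec) (b c : 'I_m -> R),
        forall (x : vec) (t : R),
          (f x <= t%:E)%E <-> (forall k, dotv (a k) x + b k * t <= c k)].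

Definition Mconvex (f : vec -> \bar R) : Prop :=
  polyhedral_convex f /\
  forall x y, domR f x -> domR f y ->
  forall i, y 0 i < x 0 i ->
  exists j, x 0 j < y 0 j /\
    exists2 eps0 : R, 0 < eps0 &
      forall eps : R, 0 <= eps <= eps0 ->
        (f (x - eps *: dirv i j)%R + f (y + eps *: dirv i j)%R <= f x + f y)%E.

Definition fderiv (f : vec -> \bar R) (x : vec) (i j : 'I_n) : \bar R :=
  lim ((fun a : R => ((f (x + a *: dirv i j)%R - f x) * (a^-1)%:E)%E) @ (0:R)^'+).

Definition phiR (f : vec -> \bar R) (x : vec) : \bar R :=
  \big[Order.min/+oo%E]_(i < n) \big[Order.min/+oo%E]_(j < n) fderiv f x i j.

Definition is_cbar (f : vec -> \bar R) (x : vec) (i j : 'I_n) (l : R) : Prop :=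
  let S := fun lam : R =>
    0 <= lam /\ (f (x + lam *: dirv i j)%R - f x = lam%:E * fderiv f x i j)%E in
  S l /\ forall lam, S lam -> lam <= l.

Definition inc_step (f : vec -> \bar R) (p : \bar R) (i j : 'I_n) (y y' : vec) : Prop :=
  (fderiv f y i j = p /\ exists l, is_cbar f y i j l /\ y' = y + l *: dirv i j)
  \/ (fderiv f y i j <> p /\ y' = y).

Fixpoint inc_run (f : vec -> \bar R) (p : \bar R) (s : seq ('I_n * 'I_n)) (y y' : vec)
  : Prop :=
  match s with
  | [::] => y' = y
  | (i, j) :: s' => exists z, inc_step f p i j y z /\ inc_run f p s' z y'
  end.

Definition pair_order (s : seq ('I_n * 'I_n)) : Prop :=
  exists (is0 : seq 'I_n) (js : 'I_n -> seq 'I_n),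
    [/\ perm_eq is0 (enum 'I_n),
        forall i, perm_eq (js i) (enum [pred j | j != i]) &
        s = flatten [seq [seq (i, j) | j <- js i] | i <- is0]].

Definition PM_IncSlope (f : vec -> \bar R) (x y : vec) : Prop :=
  exists s, pair_order s /\ inc_run f (phiR f x) s x y.

Inductive LSD2_reach (f : vec -> \bar R) (x0 : vec) : nat -> vec -> Prop :=
  | LSD2_start : LSD2_reach f x0 0 x0
  | LSD2_next k x y : LSD2_reach f x0 k x -> (phiR f x < 0)%E ->
      PM_IncSlope f x y -> LSD2_reach f x0 k.+1 y.

End Defs.

(* Main.v *)
Require Import Defs.
From HB Require Import structures.
From mathcomp Require Import all_boot all_order all_algebra.
From mathcomp Require Import all_classical all_reals all_analysis.
From mathcomp Require Import ring lra.
Import Order.TTheory GRing.Theory Num.Theory.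
Import numFieldNormedType.Exports.
Local Open Scope classical_set_scope.
Local Open Scope ring_scope.

(** Let [p = phiR f x < 0]. Everything rests on the global bound
    [f w >= f y + p * |w - y|_1 / 2], valid at every [y] whose slopes in the
    directions [chi_i - chi_j] are all at least [p]: a violating [w] closest to
    [y] could be moved towards [y] by an M-convex exchange. For [p = 0] it is
    optimality of the output. For [p < 0] it shows that a step of slope [p] never
    creates a slope below [p]; and since the bound is attained along a path of
    slope-[p] steps, an exchange also shows that such a step destroys neither a
    finished row [i'] (all slopes [(i', _)] above [p]) nor the finished entries
    of the current row. After all pairs have been treated every slope exceeds
    [p], so [phiR] strictly increases from call to call; as the slopes of a
    polyhedral function take finitely many values, the loop terminates. *)

Set Implicit Arguments.
Unset Strict Implicit.
Unset Printing Implicit Defensive.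

(** The minimum of finitely many positive thresholds is positive; the default [1] covers an empty
    [I]. It yields one step length that suits all constraints at once. *)
Lemma uniform_right (R : realType) (I : finType) (P : I -> R -> Prop) :
  (forall i, exists2 d : R, 0 < d & forall e : R, 0 < e <= d -> P i e) ->
  exists2 d : R, 0 < d & forall i (e : R), 0 < e <= d -> P i e.
Proof.
move=> H; have /choice[g Hg] : forall i, exists d : R, 0 < d /\ forall e : R, 0 < e <= d -> P i e.
  by move=> i; have [d d0 Pd] := H i; exists d.
exists (\big[Num.min/1]_i g i).
  by apply: lt_bigmin => // i _; case: (Hg i).
move=> i e /andP[e0 eg]; apply: (Hg i).2; rewrite e0 (le_trans eg) //.
exact: bigmin_le.
Qed.

(** The entry [v] itself is counted on the right but not on the left. This turns strict growth of
    [phiR] into growth of a bounded natural number. *)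
Lemma count_lt_mem (d : Order.disp_t) (T : orderType d) (s : seq T) (v w : T) :
  v \in s -> (v < w)%O ->
  (count (fun t => (t < v)%O) s < count (fun t => (t < w)%O) s)%N.
Proof.
move=> /perm_to_rem/permP count_rem vw.
rewrite !count_rem /= ltxx vw add0n add1n ltnS.
by apply: sub_count => t /= tv; exact: lt_trans vw.
Qed.

(** * Exchange directions and the l1 distance *)

Section Vectors.
Variables (R : realType) (n : nat).
Implicit Types (u v x d : 'rV[R]_n) (i j k : 'I_n).

Definition l1 u : R := \sum_k `|u 0 k|.

Lemma dotvD u v d t : dotv u (v + t *: d) = dotv u v + t * dotv u d.
Proof.
rewrite /dotv mulr_sumr -big_split /=; apply: eq_bigr => k _.
by rewrite !mxE; ring.
Qed.

Lemma dirvE i j k : dirv R i j 0 k = (k == i)%:R - (k == j)%:R.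
Proof. by rewrite /dirv /chi !mxE eqxx. Qed.

Lemma addZ_dirvE u t i j k :
  (u + t *: dirv R i j) 0 k = u 0 k + t * ((k == i)%:R - (k == j)%:R).
Proof. by rewrite -dirvE !mxE. Qed.

Lemma ler_l1D u v : l1 (u + v) <= l1 u + l1 v.
Proof.
rewrite /l1 -big_split /=; apply: ler_sum => k _.
by rewrite !mxE ler_normD.
Qed.

Lemma l1Z t u : l1 (t *: u) = `|t| * l1 u.
Proof. by rewrite /l1 mulr_sumr; apply: eq_bigr => k _; rewrite !mxE normrM. Qed.

Lemma l10 : l1 0 = 0.
Proof. by rewrite /l1 big1 // => k _; rewrite mxE normr0. Qed.

Lemma l1_dirv_le i j : l1 (dirv R i j) <= 2.
Proof.
have sum1 (i0 : 'I_n) : \sum_k (k == i0)%:R = 1 :> R.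
  by rewrite (bigD1 i0) //= eqxx big1 ?addr0 // => k /negPf ->.
apply: (@le_trans _ _ (\sum_k ((k == i)%:R + (k == j)%:R))).
  apply: ler_sum => k _; rewrite dirvE.
  by rewrite (le_trans (ler_normB _ _))// !ger0_norm // ler0n.
by rewrite big_split /= !sum1.
Qed.

(** Neither coordinate overshoots zero, so both absolute values drop by exactly [e]. *)
Lemma l1_transfer u i j e : i != j -> 0 <= e -> e <= u 0 i -> e <= - u 0 j ->
  l1 (u - e *: dirv R i j) = l1 u - 2 * e.
Proof.
move=> ij e0 ei ej; rewrite /l1.
rewrite [LHS](bigD1 i) //= (bigD1 j) 1?eq_sym //=.
rewrite [in RHS](bigD1 i) //= [in RHS](bigD1 j) 1?eq_sym //=.
have -> : \sum_(k | (k != i) && (k != j)) `|(u - e *: dirv R i j) 0 k| =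
    \sum_(k | (k != i) && (k != j)) `|u 0 k|.
  apply: eq_bigr => k /andP[/negPf ki /negPf kj].
  by rewrite -scaleNr addZ_dirvE ki kj subr0 mulr0 addr0.
rewrite -scaleNr !addZ_dirvE !eqxx [j == i]eq_sym (negPf ij).
rewrite subr0 mulr1 sub0r mulrN1 opprK.
rewrite (ger0_norm (_ : 0 <= u 0 i - e)) ?subr_ge0 //.
rewrite (ger0_norm (_ : 0 <= u 0 i)) ?(le_trans e0) //.
rewrite (ler0_norm (_ : u 0 j + e <= 0)); last lra.
rewrite (ler0_norm (_ : u 0 j <= 0)); last lra.
lra.
Qed.

Lemma l1_continuous y : continuous (fun z : 'rV[R]_n => l1 (z - y)).
Proof.
apply: continuous_big => [|k _ z]; first exact: add_continuous.
have -> : (fun x : 'rV[R]_n => `|(x - y) 0 k|) = (fun x => `|x 0 k + (- y) 0 k|).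
  by apply/funext => x; rewrite mxE.
exact: (cvg_norm (cvgD (@coord_continuous R 1 n 0 k z) (cvg_cst ((- y) 0 k)))).
Qed.

Lemma dotv_continuous u : continuous (dotv u : 'rV[R]_n -> R).
Proof.
apply: continuous_big => [|k _ z]; first exact: add_continuous.
exact: (cvgM (cvg_cst (u 0 k)) (@coord_continuous R 1 n 0 k z)).
Qed.

Lemma dotv_l1_continuous u y r s p :
  continuous (fun z : 'rV[R]_n => dotv u z + r * (s + p * (l1 (z - y) / 2))).
Proof.
move=> z; apply: continuousD; first exact: dotv_continuous.
apply: continuousM; first exact: cst_continuous.
apply: continuousD; first exact: cst_continuous.
apply: continuousM; first exact: cst_continuous.
apply: continuousM; last exact: cst_continuous.
exact: l1_continuous.
Qed.

Lemma coord_le_norm (x : 'rV[R]_n) i : `|x 0 i| <= `|x|.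
Proof.
rewrite [leRHS]/Num.norm /= mx_normrE.
by apply/bigmax_geP; right => /=; exists (0, i).
Qed.

End Vectors.

(** * Slopes of a polyhedral function *)

Section Polyhedral.
Variables (R : realType) (n m : nat) (f : 'rV[R]_n -> \bar R).
Variables (a : 'I_m -> 'rV[R]_n) (b c : 'I_m -> R).
Hypothesis fNy : forall x, f x <> -oo%E.
Hypothesis epi : forall (x : 'rV[R]_n) (t : R),
  (f x <= t%:E)%E <-> (forall k, dotv (a k) x + b k * t <= c k).
Implicit Types (x y d : 'rV[R]_n) (i j : 'I_n).

Let F x := fine (f x).

Lemma domR_fine x : domR f x -> f x = (fine (f x))%:E.
Proof. by rewrite /domR /=; have := @fNy x; case: (f x). Qed.

Lemma domR_le x t : (f x <= t%:E)%E -> domR f x /\ F x <= t.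
Proof.
move=> fxt; have dx : domR f x by rewrite /domR /= (le_lt_trans fxt) ?ltry.
by split=> //; rewrite -lee_fin -domR_fine.
Qed.

(** An epigraph is closed upwards: with [b k > 0] a large [t] would violate constraint [k]. *)
Lemma epi_coef_le0 x k : domR f x -> b k <= 0.
Proof.
move=> dx; rewrite leNgt; apply/negP => bk.
pose t := Num.max (F x) ((c k - dotv (a k) x + 1) / b k).
have /epi /(_ k) : (f x <= t%:E)%E by rewrite domR_fine // lee_fin le_max lexx.
have : (c k - dotv (a k) x + 1) / b k <= t by rewrite le_max lexx orbT.
rewrite ler_pdivrMr // mulrC; lra.
Qed.

(** Otherwise every constraint involving [t] has slack, and the value at [x] could be lowered. *)
Lemma epi_tight x : domR f x ->
  exists2 k, b k < 0 & dotv (a k) x + b k * F x = c k.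
Proof.
move=> dx; apply: contrapT => ntight.
have fx : forall k, dotv (a k) x + b k * F x <= c k.
  by apply/epi; rewrite domR_fine.
have [|e e0 He] := @uniform_right R 'I_m
    (fun k e => dotv (a k) x + b k * (F x - e) <= c k).
  move=> k; have := epi_coef_le0 k dx; rewrite le_eqVlt => /predU1P[bk|bk].
    by exists 1 => // e _; have := fx k; rewrite bk !mul0r.
  have sk : dotv (a k) x + b k * F x < c k.
    by rewrite lt_neqAle fx andbT; apply/eqP => ?; apply: ntight; exists k.
  exists ((c k - (dotv (a k) x + b k * F x)) / - b k).
    by rewrite divr_gt0 ?oppr_gt0 // subr_gt0.
  move=> e /andP[_]; rewrite ler_pdivlMr ?oppr_gt0 //; nra.
have : (f x <= (F x - e)%:E)%E.
  by apply/epi => k; apply: He; rewrite e0 lexx.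
by rewrite domR_fine // lee_fin /F; lra.
Qed.

(** A constraint with [b k < 0] is an affine minorant of [f] whose slope along [d] is the listed
    quotient; [+oo] stands for leaving the domain. Division by zero contributes a harmless extra [0]
    when [b k = 0], since only a finite superset of the slopes is wanted. *)
Definition slopes d : seq (\bar R) :=
  +oo%E :: [seq (dotv (a k) d / - b k)%:E | k <- enum 'I_m].

Lemma slopes_neq_ninfty d v : v \in slopes d -> v <> -oo%E.
Proof. by rewrite inE => /predU1P[->|/mapP[k _ ->]]. Qed.

(** Either [d] leaves a tight constraint with [b k = 0], and the slope is [+oo], or the slope is the
    maximum over the tight constraints with [b k < 0]. The maximizing constraint gives the global
    lower bound; all the others permit equality for small [e]. *)
Lemma local_slope y d : domR f y -> exists v : \bar R,
  [/\ v \in slopes d,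
     (forall e : R, 0 < e -> (f y + e%:E * v <= f (y + e *: d)%R)%E) &
     exists2 e0 : R, 0 < e0 &
       forall e : R, 0 < e <= e0 -> f (y + e *: d)%R = (f y + e%:E * v)%E].
Proof.
move=> dy; have fyle : forall k, dotv (a k) y + b k * F y <= c k.
  by apply/epi; rewrite domR_fine.
have [[k [bk ck dk]]|infeas] := pselect (exists k,
    [/\ b k = 0, dotv (a k) y = c k & 0 < dotv (a k) d]).
  have fy e : 0 < e -> f (y + e *: d)%R = +oo%E.
    move=> e0; have := @fNy (y + e *: d).
    case E : (f _) => [r| |] // _.
    have /epi/(_ k) : (f (y + e *: d)%R <= r%:E)%E by rewrite E.
    rewrite dotvD bk mul0r ck => h; exfalso.
    by have := mulr_gt0 e0 dk; lra.
  exists +oo%E; split; first by rewrite inE eqxx.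
    by move=> e e0; rewrite fy // leey.
  exists 1 => // e /andP[e0 _].
  by rewrite fy // gt0_muley ?lte_fin // domR_fine.
pose T := [pred k | (b k < 0) && (dotv (a k) y + b k * F y == c k)].
have [k0 bk0 tk0] := epi_tight dy.
have Tk0 : T k0 by rewrite /= bk0 tk0 eqxx.
case: (@arg_maxP _ R _ k0 T (fun k => dotv (a k) d / - b k) Tk0).
move=> k /andP[bk /eqP tk] kmax; set v := _ / _ in kmax.
have vE : dotv (a k) d = v * - b k by rewrite divfK // oppr_eq0 lt_eqF.
have lb e : 0 < e -> (f y + e%:E * v%:E <= f (y + e *: d)%R)%E.
  move=> e0; have := @fNy (y + e *: d).
  case E : (f (y + e *: d)%R) => [r| |] // _; last by rewrite leey.
  have /epi/(_ k) : (f (y + e *: d)%R <= r%:E)%E by rewrite E.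
  rewrite domR_fine // -EFinM -EFinD lee_fin dotvD vE -tk /F; nra.
exists v%:E; split => //.
  by rewrite inE; apply/orP; right; apply/mapP; exists k; rewrite ?mem_enum.
have [|e e0 He] := @uniform_right R 'I_m
    (fun k e => dotv (a k) (y + e *: d)%R + b k * (F y + e * v) <= c k).
  move=> l; have := fyle l; rewrite le_eqVlt => /predU1P[tl|sl].
    exists 1 => // e /andP[e0 _]; rewrite dotvD.
    have := epi_coef_le0 l dy; rewrite le_eqVlt => /predU1P[bl|bl].
      rewrite bl mul0r addr0 in tl *.
      have [dl|dl] := leP (dotv (a l) d) 0; first by nra.
      by case: infeas; exists l.
    have /= := kmax l; rewrite /T /= bl tl eqxx => /(_ isT).
    rewrite ler_pdivrMr ?oppr_gt0 // => dl; rewrite -tl; nra.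
  set s := c l - (dotv (a l) y + b l * F y).
  have s0 : 0 < s by rewrite subr_gt0.
  set g := dotv (a l) d + b l * v.
  (* A slack constraint survives while [e * g <= s]; adding [1] keeps the denominator positive. *)
  exists (s / (`|g| + 1)); first by rewrite divr_gt0 // ltr_wpDl.
  move=> e /andP[e0]; rewrite ler_pdivlMr ?ltr_wpDl // => es.
  have : e * g <= s.
    apply: le_trans es; rewrite ler_pM2l //.
    by rewrite (le_trans (ler_norm _)) // lerDl.
  rewrite /s /g dotvD; lra.
exists e => // e' /andP[e'0 e'e]; apply/eqP; rewrite eq_le lb // andbT.
rewrite (domR_fine dy) -EFinM -EFinD; apply/epi => l.
by apply: He; rewrite e'0.
Qed.

(** The difference quotient is constant near [0] from the right, so its limit is the local slope. *)
Lemma fderiv_slope y i j : domR f y ->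
  [/\ fderiv f y i j \in slopes (dirv R i j),
     (forall e : R, 0 < e ->
        (f y + e%:E * fderiv f y i j <= f (y + e *: dirv R i j)%R)%E) &
     exists2 e0 : R, 0 < e0 & forall e : R, 0 < e <= e0 ->
       f (y + e *: dirv R i j)%R = (f y + e%:E * fderiv f y i j)%E].
Proof.
move=> dy; have [v [vs vlb veq]] := local_slope (dirv R i j) dy.
suff -> : fderiv f y i j = v by [].
have [e0 e00 He] := veq.
apply: cvg_lim => //.
apply: (@cvg_trans _ ((fun _ : R => v) @ (0:R)^'+)); last exact: cvg_cst.
apply: near_eq_cvg; near=> e.
have e_gt0 : 0 < e by near: e; exact: nbhs_right_gt.
rewrite He; last first.
  by rewrite e_gt0 /=; near: e; exact: nbhs_right_le.
rewrite (domR_fine dy).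
have := slopes_neq_ninfty vs.
case: (v) => [r| |] // _.
  rewrite -EFinM; congr EFin.
  by rewrite addrAC subrr add0r mulrAC divff ?mul1r // gt_eqF.
rewrite gt0_muley ?lte_fin //= addye //.
by rewrite gt0_mulye // lte_fin invr_gt0.
Unshelve. all: by end_near.
Qed.

Lemma fderiv_ge y i j p e : domR f y -> (p%:E <= fderiv f y i j)%E -> 0 <= e ->
  domR f (y + e *: dirv R i j) -> F y + e * p <= F (y + e *: dirv R i j).
Proof.
move=> dy pf; rewrite le_eqVlt => /predU1P[<- _|e0 de].
  by rewrite scale0r addr0 mul0r addr0.
have [_ lb _] := fderiv_slope i j dy.
rewrite -lee_fin -domR_fine // (le_trans _ (lb e e0)) //.
rewrite EFinD EFinM -domR_fine // leeD2l // lee_pmul2l //.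
Qed.

Lemma fderiv_gt y i j p e : domR f y -> (p%:E < fderiv f y i j)%E -> 0 < e ->
  domR f (y + e *: dirv R i j) -> F y + e * p < F (y + e *: dirv R i j).
Proof.
move=> dy pf e0 de; have [_ lb _] := fderiv_slope i j dy.
rewrite -lte_fin -domR_fine // (lt_le_trans _ (lb e e0)) //.
rewrite EFinD EFinM domR_fine // lteD2lE // lte_pmul2l //.
Qed.

Lemma fderiv_le y i j p : domR f y -> (fderiv f y i j <= p%:E)%E ->
  exists2 e0 : R, 0 < e0 & forall e : R, 0 < e <= e0 ->
    domR f (y + e *: dirv R i j) /\ F (y + e *: dirv R i j) <= F y + e * p.
Proof.
move=> dy pf; have [_ _ [e0 e00 He]] := fderiv_slope i j dy.
exists e0 => // e /[dup] ee /andP[e_gt0 _].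
apply: domR_le; rewrite He // EFinD EFinM -domR_fine // leeD2l // lee_pmul2l //.
Qed.

(** * The exchange property and the steepest-slope lower bound *)

Hypothesis exc : forall x y, domR f x -> domR f y ->
  forall i, y 0 i < x 0 i ->
  exists j, x 0 j < y 0 j /\
    exists2 eps0 : R, 0 < eps0 &
      forall eps : R, 0 <= eps <= eps0 ->
        (f (x - eps *: dirv R i j)%R + f (y + eps *: dirv R i j)%R <= f x + f y)%E.
Hypothesis bd : bounded_set (domR f).

Lemma phiR_le y i j : (phiR f y <= fderiv f y i j)%E.
Proof.
by rewrite /phiR; apply: le_trans (bigmin_le _ i _) _; apply: bigmin_le.
Qed.

Lemma phiR_ge y p : (forall i j, p%:E <= fderiv f y i j)%E -> (p%:E <= phiR f y)%E.
Proof.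
by move=> H; do 2![apply: le_bigmin => [|? _]; first exact: leey].
Qed.

Lemma phiR_gt y p : (forall i j, p%:E < fderiv f y i j)%E -> (p%:E < phiR f y)%E.
Proof.
by move=> H; do 2![apply: lt_bigmin => [|? _]; first exact: ltry].
Qed.

(** Capping the exchange length at both coordinate gaps makes [l1_transfer] applicable. *)
Lemma exchange x y i : domR f x -> domR f y -> y 0 i < x 0 i ->
  exists2 j, x 0 j < y 0 j & exists e : R,
    [/\ 0 < e, e <= x 0 i - y 0 i, e <= y 0 j - x 0 j,
        domR f (x - e *: dirv R i j) /\ domR f (y + e *: dirv R i j) &
        F (x - e *: dirv R i j) + F (y + e *: dirv R i j) <= F x + F y].
Proof.
move=> dx dy xy; have [j [xyj [e0 e00 He]]] := exc dx dy xy.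
exists j => //; set e := Num.min e0 (Num.min (x 0 i - y 0 i) (y 0 j - x 0 j)).
have e_gt0 : 0 < e by rewrite !lt_min e00 !subr_gt0 xy.
exists e.
have : (f (x - e *: dirv R i j)%R + f (y + e *: dirv R i j)%R <= f x + f y)%E.
  by apply: He; rewrite (ltW e_gt0) ge_min lexx.
rewrite (domR_fine dx) (domR_fine dy).
have := @fNy (x - e *: dirv R i j); have := @fNy (y + e *: dirv R i j).
rewrite /F /domR /=; case: (f (x - _)) (f (y + _)) => [r| |] [s| |] // _ _ h.
by split; rewrite ?ltry // /e !ge_min !lexx !orbT.
Qed.

(* A counterexample [w] closest to [y] could be moved towards [y] by an exchange. *)
Lemma steepest_lower_bound y p w : domR f y -> (p%:E <= phiR f y)%E ->
  domR f w -> F y + p * (l1 (w - y) / 2) <= F w.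
Proof.
move=> dy pphi dw; set C := F w - p * (l1 (w - y) / 2).
(* [K] holds the points lying at least as low as [w] relative to the bound. Stated through the
   epigraph inequalities it is visibly closed, hence compact, and has a point closest to [y]. *)
pose K := [set z | forall k, dotv (a k) z + b k * (C + p * (l1 (z - y) / 2)) <= c k].
have KP z : K z -> domR f z /\ F z <= C + p * (l1 (z - y) / 2).
  by move=> /epi /domR_le.
have Kw : K w by apply/epi; rewrite /C subrK (domR_fine dw).
have cK : compact K.
  apply: bounded_closed_compact.
    by case: bd => M [Mr HM]; exists M; split=> // M' /HM + z /KP[dz _]; exact.
  have -> : K = \bigcap_k
      ((fun z : 'rV[R]_n => dotv (a k) z + b k * (C + p * (l1 (z - y) / 2))) @^-1`
         [set t | t <= c k]).
    by apply/seteqP; split => z Kz k => [_|]; apply: Kz.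
  apply: closed_bigI => k _; apply: preimage_closed; last exact: closed_le.
  by move=> z _; exact: dotv_l1_continuous.
have [||z] := @compact_EVT_min _ R (fun z : 'rV[R]_n => l1 (z - y)) K _ cK.
- by exists w.
- by apply: continuous_subspaceT; exact: l1_continuous.
rewrite inE => Kz zmin; have [dz Fz] := KP z Kz.
have [zy|zNy] := eqVneq z y.
  by move: Fz; rewrite zy subrr l10 mul0r mulr0 /C; lra.
(* If [z] were nowhere larger, an exchange at a coordinate where it is smaller would itself supply a
   larger one. *)
have [i zyi] : exists i, y 0 i < z 0 i.
  apply: contrapT => nz; have zy k : z 0 k <= y 0 k.
    by rewrite leNgt; apply/negP => ?; apply: nz; exists k.
  have [k zyk] : exists k, z 0 k < y 0 k.
    apply: contrapT => nz'; move/eqP: zNy; apply; apply/rowP => k.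
    apply/eqP; rewrite eq_le zy leNgt; apply/negP => ?; by apply: nz'; exists k.
  by have [j yzj _] := exchange dy dz zyk; apply: nz; exists j.
have [j zyj [e [e0 ei ej [dz' dy'] Fe]]] := exchange dz dy zyi.
have ij : i != j by apply/eqP => ij; move: zyj; rewrite -ij; lra.
have pij : (p%:E <= fderiv f y i j)%E by apply: le_trans pphi (phiR_le _ _ _).
have Fy := fderiv_ge dy pij (ltW e0) dy'.
have nrm : l1 (z - e *: dirv R i j - y) = l1 (z - y) - 2 * e.
  by rewrite addrAC l1_transfer // ?(ltW e0) // !mxE ?opprB.
(* The value at [y] changes by at least [e * p], so the one at [z] rises by at most [- e * p], just
   as the bound does when the distance drops by [2 * e]: the moved point stays in [K]. *)
have : l1 (z - y) <= l1 (z - e *: dirv R i j - y).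
  apply: zmin; rewrite inE; apply/epi; rewrite (domR_fine dz') lee_fin nrm.
  by move: Fe Fy Fz; rewrite /F; lra.
by rewrite nrm; lra.
Qed.

(** If the exchanged direction had slope above [p] at [y], the exchange would move [w], where the
    bound is attained, strictly below the bound. *)
Lemma tight_out y p w i : domR f y -> (p%:E <= phiR f y)%E -> domR f w ->
  F w <= F y + p * (l1 (w - y) / 2) -> y 0 i < w 0 i ->
  exists2 j, w 0 j < y 0 j & (fderiv f y i j <= p%:E)%E.
Proof.
move=> dy pphi dw Fw wi.
have [j wj [e [e0 ei ej [dw' dy'] Fe]]] := exchange dw dy wi.
have ij : i != j by apply/eqP => ij; move: wj; rewrite -ij; lra.
exists j => //; rewrite leNgt; apply/negP => pij.
have Fy := fderiv_gt dy pij e0 dy'.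
have := steepest_lower_bound dy pphi dw'.
rewrite addrAC l1_transfer ?(ltW e0) // ?mxE ?opprB //; lra.
Qed.

(** Mirror image of [tight_out]: the exchange starts from the coordinate where [y] is larger. *)
Lemma tight_in y p w j : domR f y -> (p%:E <= phiR f y)%E -> domR f w ->
  F w <= F y + p * (l1 (w - y) / 2) -> w 0 j < y 0 j ->
  exists2 i, y 0 i < w 0 i & (fderiv f y i j <= p%:E)%E.
Proof.
move=> dy pphi dw Fw wj.
have [i wi [e [e0 ej ei]]] := exchange dy dw wj.
have -> : dirv R j i = - dirv R i j by rewrite /dirv opprB.
rewrite scalerN opprK => -[dy' dw'] Fe.
have ij : i != j by apply/eqP => ij; move: wj; rewrite -ij; lra.
exists i => //; rewrite leNgt; apply/negP => pij.
have Fy := fderiv_gt dy pij e0 dy'.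
have := steepest_lower_bound dy pphi dw'.
rewrite addrAC l1_transfer ?(ltW e0) // ?mxE ?opprB //; lra.
Qed.

(** Local linearity makes [l] positive. A slope at most [p] at the endpoint would allow a longer
    step, against the maximality of [l]. *)
Lemma is_cbarP y i j p l : domR f y -> fderiv f y i j = p%:E ->
  is_cbar f y i j l ->
  [/\ 0 < l, domR f (y + l *: dirv R i j),
     F (y + l *: dirv R i j) = F y + l * p &
     (p%:E < fderiv f (y + l *: dirv R i j) i j)%E].
Proof.
move=> dy fp [[l0 fl] lmax].
have tightS t : 0 <= t -> domR f (y + t *: dirv R i j) ->
    F (y + t *: dirv R i j) <= F y + t * p -> t <= l.
  move=> t0 dt Ft; apply: lmax; split=> //.
  rewrite fp (domR_fine dt) (domR_fine dy) -EFinB -EFinM; congr EFin.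
  have := @fderiv_ge y i j p t dy; rewrite fp => /(_ (lexx _) t0 dt).
  by move: Ft; rewrite /F; lra.
have fle : (fderiv f y i j <= p%:E)%E by rewrite fp.
have [e e0 He] := fderiv_le dy fle.
have l_gt0 : 0 < l.
  apply: (lt_le_trans e0); have [|de Fe] := He e; first by rewrite e0 lexx.
  by apply: tightS => //; exact: ltW.
have [dl Fl] : domR f (y + l *: dirv R i j) /\ F (y + l *: dirv R i j) = F y + l * p.
  move: fl; rewrite fp (domR_fine dy) /F /domR /=; have := @fNy (y + l *: dirv R i j).
  case: (f _) => [r| |] // _; rewrite -EFinM -EFinB => -[fl]; rewrite ltry; split=> //=.
  by rewrite -fl addrC subrK.
split=> //; rewrite ltNge; apply/negP => /(fderiv_le dl)[t t0].
move=> /(_ t); rewrite t0 lexx -addrA -scalerDl => /(_ isT)[dt Ft].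
have := tightS (l + t); rewrite addr_ge0 ?(ltW t0) // => /(_ isT dt).
by move: Ft; rewrite Fl mulrDl; lra.
Qed.

(** Admissible lengths are cut out by finitely many weak linear inequalities. They are bounded
    because coordinate [i] grows with the length inside a bounded domain, so the supremum is
    attained. *)
Lemma is_cbar_ex y i j p : domR f y -> i != j -> fderiv f y i j = p%:E ->
  exists l, is_cbar f y i j l.
Proof.
move=> dy ij fp; pose d := dirv R i j.
pose g k := dotv (a k) d + b k * p.
pose s k := c k - (dotv (a k) y + b k * F y).
pose S := [set t : R | 0 <= t /\ forall k, t * g k <= s k].
have SP t : S t <-> 0 <= t /\ (f (y + t *: d)%R - f y = t%:E * fderiv f y i j)%E.
  rewrite fp; have -> : (0 <= t /\ (f (y + t *: d)%R - f y = t%:E * p%:E)%E) <->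
      0 <= t /\ (f (y + t *: d)%R <= (F y + t * p)%:E)%E.
    split=> -[t0 h]; split=> //; move: h.
      rewrite (domR_fine dy) /F; have := @fNy (y + t *: d).
      by case: (f (y + t *: d)) => [r| |] // _ [h]; rewrite lee_fin; lra.
    move=> /domR_le[dt Ft].
    rewrite (domR_fine dt) (domR_fine dy) -EFinB -EFinM; congr EFin.
    have := @fderiv_ge y i j p t dy; rewrite fp => /(_ (lexx _) t0 dt).
    by move: Ft; rewrite /F /d; lra.
  rewrite epi; split=> -[t0 h]; split=> // k; have := h k;
    rewrite dotvD /g /s; lra.
have S0 : S 0.
  split=> // k; rewrite mul0r subr_ge0; move: k; apply/epi.
  by rewrite (domR_fine dy).
have Sub : has_ubound S.
  have [M [_ HM]] := bd; exists (`|M| + 1 - y 0 i) => t /SP[t0 ht].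
  have dt : domR f (y + t *: d).
    move: ht; rewrite fp (domR_fine dy) /domR /=.
    by case: (f _) => [r| |] //; rewrite ltry.
  rewrite lerBrDr addrC; have -> : y 0 i + t = (y + t *: d) 0 i.
    by rewrite addZ_dirvE eqxx (negPf ij) subr0 mulr1.
  apply: (le_trans (ler_norm _)); apply: (le_trans (coord_le_norm _ _)).
  by apply: HM dt; rewrite ltr_pwDr // ler_norm.
have S_sup : S (sup S).
  have sup0 : 0 <= sup S by apply: ub_le_sup.
  split=> // k; have [gk|gk] := leP (g k) 0.
    have := S0.2 k; rewrite mul0r; apply: le_trans.
    by rewrite mulr_ge0_le0.
  rewrite -ler_pdivlMr //; apply: ge_sup; first by exists 0.
  by move=> t [_ /(_ k)]; rewrite -ler_pdivlMr.
exists (sup S); split; first exact/SP.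
by move=> t /SP St; apply: ub_le_sup.
Qed.

(** * Steps of the algorithm *)

Section SteepestStep.
Variables (y : 'rV[R]_n) (p l : R) (i j : 'I_n).
Hypotheses (dy : domR f y) (p_lt0 : p < 0) (pphi : (p%:E <= phiR f y)%E).
Let z := y + l *: dirv R i j.
Hypotheses (l_gt0 : 0 < l) (dz : domR f z) (Fz : F z = F y + l * p).

Let shiftE r s e : z + e *: dirv R r s - y = l *: dirv R i j + e *: dirv R r s.
Proof. by rewrite /z -(addrA y) [y + _]addrC addrK. Qed.

Let l1_shift r s e : 0 <= e ->
  p * (l + e) <= p * (l1 (z + e *: dirv R r s - y) / 2).
Proof.
move=> e0; rewrite ler_nM2l // ler_pdivrMr // shiftE.
rewrite (le_trans (ler_l1D _ _)) // mulrDl lerD //;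
  by rewrite l1Z ger0_norm ?ler_wpM2l ?l1_dirv_le // ltW.
Qed.

(** Following the step by a move of slope [q < p] would end below the bound taken at [y], because
    the two moves together have l1 length at most [2 * (l + e)]. *)
Lemma step_phiR : (p%:E <= phiR f z)%E.
Proof.
apply: phiR_ge => r s; rewrite leNgt; apply/negP => prs.
have [q qp fq] : exists2 q : R, q < p & (fderiv f z r s <= q%:E)%E.
  have [+ _ _] := fderiv_slope r s dz; move: prs.
  case: (fderiv f z r s) => [q| |] //; last by move=> _ /slopes_neq_ninfty.
  by rewrite lte_fin => qp _; exists q.
have [e e0 /(_ e)] := fderiv_le dz fq; rewrite e0 lexx => /(_ isT)[dw Fw].
have := steepest_lower_bound dy pphi dw.
have : e * q < e * p by rewrite ltr_pM2l.
by have := l1_shift r s (ltW e0); move: Fw; rewrite Fz; lra.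
Qed.

(* The new direction cannot cancel against the old one: otherwise [y] would
   reach the same point by a shorter path, against [steepest_lower_bound]. *)
Lemma step_tight r s : r != s -> (fderiv f z r s <= p%:E)%E ->
  [/\ r != j, s != i & exists e : R, [/\ 0 < e, domR f (z + e *: dirv R r s) &
    F (z + e *: dirv R r s) <= F y + p * (l1 (z + e *: dirv R r s - y) / 2)]].
Proof.
move=> rs /(fderiv_le dz)[e0 e00 He].
(* The cap at [l] keeps [l - e], the part of the old step left after a cancellation, nonnegative. *)
pose e := Num.min e0 l; have e_gt0 : 0 < e by rewrite lt_min e00.
have el : e <= l by rewrite ge_min lexx orbT.
have [|dw Fw] := He e; first by rewrite e_gt0 ge_min lexx.
have lb := steepest_lower_bound dy pphi dw.
have nocancel r' s' :
    z + e *: dirv R r s - y <> (l - e) *: dirv R i j + e *: dirv R r' s'.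
  move=> E; have : l1 (z + e *: dirv R r s - y) / 2 <= l.
    rewrite ler_pdivrMr // mulrC.
    rewrite E (le_trans (ler_l1D _ _)) // -[in leRHS](subrK e l) mulrDr !(mulrC 2).
    by rewrite lerD // l1Z ger0_norm ?ler_wpM2l ?l1_dirv_le ?subr_ge0 // ltW.
  rewrite -(ler_nM2l p_lt0); have : e * p < 0 by rewrite pmulr_rlt0.
  by move: lb Fw; rewrite Fz; lra.
split.
- apply/eqP => rj; apply: (nocancel i s); rewrite shiftE rj /dirv.
  by apply/rowP => k; rewrite !mxE; ring.
- apply/eqP => si; apply: (nocancel r j); rewrite shiftE si /dirv.
  by apply/rowP => k; rewrite !mxE; ring.
- exists e; split=> //; apply: (le_trans Fw); rewrite Fz.
  by have := l1_shift r s (ltW e_gt0); lra.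
Qed.

(** A slope at most [p] at [z] gives a point attaining the bound with coordinate [r] raised above
    [y]; [tight_out] then finds a slope at most [p] in row [r] at [y]. *)
Lemma step_other_row r : r != i ->
  (forall h, h != r -> (p%:E < fderiv f y r h)%E) ->
  forall s, s != r -> (p%:E < fderiv f z r s)%E.
Proof.
move=> ri rdone s sr; rewrite ltNge; apply/negP => prs.
have [|rj si [e [e0 dw Fw]]] := step_tight _ prs; first by rewrite eq_sym.
have yr : y 0 r < (z + e *: dirv R r s) 0 r.
  rewrite /z !addZ_dirvE eqxx [r == s]eq_sym (negPf ri) (negPf rj) (negPf sr).
  by rewrite !subr0 mulr0 addr0 mulr1 ltrDl.
have [h wh] := tight_out dy pphi dw Fw yr.
apply/negP; rewrite -ltNge; apply: rdone; apply/eqP => hr.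
by move: wh; rewrite hr; move: yr; lra.
Qed.

(** Here coordinate [s] ends below [y] and only coordinate [i] can end above it, so [tight_in]
    blames the pair [(i, s)] at [y]. *)
Lemma step_same_row s : s != i -> s != j ->
  (p%:E < fderiv f y i s)%E -> (p%:E < fderiv f z i s)%E.
Proof.
move=> si sj pis; rewrite ltNge; apply/negP => prs.
have [|ij _ [e [e0 dw Fw]]] := step_tight _ prs; first by rewrite eq_sym.
have ys : (z + e *: dirv R i s) 0 s < y 0 s.
  rewrite /z !addZ_dirvE eqxx (negPf si) (negPf sj).
  by rewrite subrr mulr0 addr0 sub0r mulrN1 gtrBl.
have [h wh] := tight_in dy pphi dw Fw ys.
apply/negP; rewrite -ltNge; suff -> : h = i by [].
apply/eqP; apply: contraTT wh => /negPf hi; rewrite -leNgt /z !addZ_dirvE hi.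
rewrite !sub0r !mulrN -addrA -opprD gerBl.
by apply: addr_ge0; apply: mulr_ge0; rewrite ?ler0n // ltW.
Qed.

End SteepestStep.

Lemma inc_step_inv p i j y z : domR f y -> p < 0 -> (p%:E <= phiR f y)%E ->
  inc_step f p%:E i j y z ->
  [/\ domR f z /\ (p%:E <= phiR f z)%E, (p%:E < fderiv f z i j)%E,
     (forall s, s != i -> (p%:E < fderiv f y i s)%E -> (p%:E < fderiv f z i s)%E) &
     (forall r, r != i ->
        (forall h, h != r -> (p%:E < fderiv f y r h)%E) ->
        forall h, h != r -> (p%:E < fderiv f z r h)%E)].
Proof.
move=> dy p0 pphi [[fp [l [cl ->]]]|[fp ->]]; last first.
  split; [by split| |by []|by []]; rewrite lt_neqAle (le_trans pphi (phiR_le _ _ _)) andbT.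
  by apply/eqP => e; apply: fp.
have [l0 dz Fz pz] := is_cbarP dy fp cl.
split; [|exact: pz| |].
- by split; [exact: dz|exact: step_phiR].
- move=> s si ps; have [->|sj] := eqVneq s j; first exact: pz.
  exact: step_same_row.
- by move=> r ri rdone h hr; apply: (step_other_row dy p0 pphi l0 dz Fz ri rdone).
Qed.

(** * Complete passes of PM-IncSlope *)

Definition row_done p y r := forall h, h != r -> (p%:E < fderiv f y r h)%E.

Lemma inc_run_cat p s1 s2 y z : inc_run f p (s1 ++ s2) y z <->
  exists2 w, inc_run f p s1 y w & inc_run f p s2 w z.
Proof.
elim: s1 y => [|[i j] s1 IH] y /=; first by split=> [|[_ ->]//]; exists y.
split=> [[w [st /IH[v rv rw]]]|[v [w [st rv]] rw]].
  by exists v => //; exists w.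
by exists w; split=> //; apply/IH; exists v.
Qed.

Lemma inc_run_row p i js y z : domR f y -> p < 0 -> (p%:E <= phiR f y)%E ->
  inc_run f p%:E [seq (i, j) | j <- js] y z ->
  [/\ domR f z /\ (p%:E <= phiR f z)%E,
     (forall s, s != i -> s \in js \/ (p%:E < fderiv f y i s)%E ->
        (p%:E < fderiv f z i s)%E) &
     (forall r, r != i -> row_done p y r -> row_done p z r)].
Proof.
move=> dy p0; elim: js y dy => [|j js IH] y dy pphi /=.
  by move=> ->; split=> // s _ [].
move=> [w [st rw]]; have [[dw pw] fij same other] := inc_step_inv dy p0 pphi st.
have [dz samez otherz] := IH w dw pw rw.
split; [exact: dz| |by move=> r ri rdone; exact: otherz (other r ri rdone)].
move=> s si ps; apply: samez => //; case: ps => [|ps]; last by right; exact: same.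
by rewrite inE => /predU1P[->|sjs]; [right|left].
Qed.

Lemma inc_run_rows p is0 (js : 'I_n -> seq 'I_n) y z :
  (forall i, perm_eq (js i) (enum [pred j | j != i])) ->
  domR f y -> p < 0 -> (p%:E <= phiR f y)%E ->
  inc_run f p%:E (flatten [seq [seq (i, j) | j <- js i] | i <- is0]) y z ->
  domR f z /\ forall r, r \in is0 \/ row_done p y r -> row_done p z r.
Proof.
move=> hjs dy p0; elim: is0 y dy => [|i is0 IH] y dy pphi /=.
  by move=> ->; split=> // r [].
move=> /inc_run_cat[w rw rz].
have [[dw pw] same other] := inc_run_row dy p0 pphi rw.
have [dz donez] := IH w dw pw rz.
split=> // r hr; apply: donez; have [->|ri] := eqVneq r i.
  by right=> h hi; apply: same => //; left; rewrite (perm_mem (hjs i)) mem_enum.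
case: hr => [|rdone]; last by right; exact: other.
by rewrite inE (negPf ri); left.
Qed.

Lemma phiR_row_done p y : domR f y -> p < 0 -> (forall r, row_done p y r) ->
  (p%:E < phiR f y)%E.
Proof.
move=> dy p0 rdone; apply: phiR_gt => r s; have [->|sr] := eqVneq s r; last exact: rdone.
(* On the diagonal the direction is zero, so a negative slope would make [F y] smaller than
   itself. *)
rewrite ltNge; apply/negP => /(fderiv_le dy)[e e0 /(_ e)].
rewrite e0 lexx /dirv subrr scaler0 addr0 => /(_ isT)[_]; nra.
Qed.

Lemma PM_IncSlope_phiR p y z : domR f y -> p < 0 -> phiR f y = p%:E ->
  PM_IncSlope f y z -> domR f z /\ (phiR f y < phiR f z)%E.
Proof.
move=> dy p0 py [s [[is0 [js [his hjs ->]]]]]; rewrite py => run.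
have [|dz rdone] := inc_run_rows hjs dy p0 _ run; first by rewrite py.
split=> //; apply: phiR_row_done => // r; apply: rdone.
by left; rewrite (perm_mem his) mem_enum.
Qed.

Lemma inc_run_ex p s y : domR f y -> all (fun ij => ij.1 != ij.2) s ->
  exists z, inc_run f p%:E s y z.
Proof.
elim: s y => [|[i j] s IH] y dy /=; first by exists y.
move=> /andP[ij sneq]; have [fp|fp] := pselect (fderiv f y i j = p%:E).
  have [l cl] := is_cbar_ex dy ij fp.
  have [_ dz _ _] := is_cbarP dy fp cl; have [z rz] := IH _ dz sneq.
  by exists z, (y + l *: dirv R i j); split=> //; left; split=> //; exists l.
by have [z rz] := IH _ dy sneq; exists z, y; split=> //; right.
Qed.

Lemma PM_IncSlope_ex p y : domR f y -> phiR f y = p%:E -> exists z, PM_IncSlope f y z.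
Proof.
move=> dy py; pose js i := enum [pred j | j != i].
pose s := flatten [seq [seq (i, j) | j <- js i] | i <- enum 'I_n].
have [|z rz] := @inc_run_ex p s y dy.
  apply/allP => _ /flatten_mapP[i _ /mapP[j + ->]] /=.
  by rewrite mem_enum eq_sym.
exists z, s; rewrite py; split=> //.
by exists (enum 'I_n), js.
Qed.

(** * Finitely many slopes and termination *)

Definition all_slopes : seq (\bar R) :=
  +oo%E :: flatten
    [seq slopes (dirv R ij.1 ij.2) | ij <- enum {: 'I_n * 'I_n}].

Lemma phiR_slopes y : domR f y -> phiR f y \in all_slopes.
Proof.
move=> dy; have minS u v : u \in all_slopes -> v \in all_slopes -> Order.min u v \in all_slopes.
  by rewrite /Order.min; case: ifP.
have S0 : +oo%E \in all_slopes by rewrite inE eqxx.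
rewrite /phiR; elim/big_ind : _ => // i _; elim/big_ind : _ => // j _.
rewrite inE; apply/orP; right; apply/flatten_mapP; exists (i, j).
  by rewrite mem_enum.
by have [] := fderiv_slope i j dy.
Qed.

Lemma phiR_fin y : domR f y -> (phiR f y < 0)%E ->
  exists2 p : R, p < 0 & phiR f y = p%:E.
Proof.
move=> /phiR_slopes; rewrite inE => /predU1P[->//|/flatten_mapP[ij _]].
rewrite inE => /predU1P[->//|/mapP[k _ ->]]; rewrite lte_fin => h.
by eexists; first exact: h.
Qed.

(** Each call moves [phiR] strictly up within the fixed list [all_slopes], so at least one more
    entry lies below it. *)
Lemma LSD2_reach_bound x0 k x : domR f x0 -> LSD2_reach f x0 k x ->
  domR f x /\ (k <= count (fun v => (v < phiR f x)%E) all_slopes)%N.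
Proof.
move=> d0; elim=> {k x}[//|k x y _ [dx kx] phi0 run].
have [p p0 px] := phiR_fin dx phi0.
have [dy lt_phi] := PM_IncSlope_phiR dx p0 px run.
split=> //; apply: (leq_ltn_trans kx).
exact: count_lt_mem (phiR_slopes dx) lt_phi.
Qed.

End Polyhedral.

Theorem mainTheorem18 (R : realType) (n : nat) (f : 'rV[R]_n -> \bar R)
    (x0 : 'rV[R]_n) :
  Mconvex f -> bounded_set (domR f) -> domR f x0 ->
  [/\ (* PM-IncSlope is well defined at every point reached while phi < 0 *)
      (forall k x, LSD2_reach f x0 k x -> (phiR f x < 0)%E ->
         exists y, PM_IncSlope f x y),
      (* termination after finitely many calls of PM-IncSlope *)
      (exists N : nat, forall k x, LSD2_reach f x0 k x -> (k <= N)%N) &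
      (* the output (a reached point where the loop stops) minimizes f *)
      (forall k x, LSD2_reach f x0 k x -> ~ (phiR f x < 0)%E ->
         forall z, (f x <= f z)%E)].
Proof.
move=> [[fNy _ [m [a [b [c epi]]]]] exc] bd d0.
have bound k x := @LSD2_reach_bound R n m f a b c fNy epi exc bd x0 k x d0.
split.
- move=> k x /bound[dx _] phi0; have [p _ px] := phiR_fin fNy epi dx phi0.
  exact: (PM_IncSlope_ex fNy epi bd dx px).
- exists (size (all_slopes a b)) => k x /bound[_ kx].
  exact: leq_trans kx (count_size _ _).
- move=> k x /bound[dx _] /negP; rewrite -leNgt => phi0 z.
  have [dz|dz] := pselect (domR f z); last first.
    by move: dz; rewrite /domR /= ltey => /negP; rewrite negbK => /eqP ->; exact: leey.
  rewrite (domR_fine fNy dx) (domR_fine fNy dz) lee_fin.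
  have := steepest_lower_bound fNy epi exc bd dx phi0 dz.
  by rewrite mul0r addr0.
Qed.
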